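(* For every $m \in \mathbb{Z}\setminus\{0\}$, all the eigenvalues of the matrix $A_m = -\mathrm{i}\, m k A + H$ have negative real parts.
   Context: Let $M \geq 1$ be an integer, $D>0$ and $k = 2\pi/D$. The matrix $A$ is the real symmetric tridiagonal $(M+1)\times(M+1)$ matrix with zero diagonal whose off-diagonal entries are $A_{n,n+1}=A_{n+1,n}=\sqrt{n}$ for $n=1,\dots,M$ (rows and columns indexed from $1$ to $M+1$), all other entries being zero. The filter matrix $H = \mathrm{diag}\{h_0,h_1,\dots,h_M\}$ is a real diagonal $(M+1)\times(M+1)$ matrix with $h_i \leq 0$ for all $i$, $h_0 = 0$ and $h_M \neq 0$ (so $h_M<0$). *)

(* Defs.v *)
From HB Require Import structures.
From mathcomp Require Import all_boot all_order all_algebra.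
From mathcomp Require Import complex.
From mathcomp Require Import reals trigo.

Set Implicit Arguments.
Unset Strict Implicit.
Unset Printing Implicit Defensive.

Import Order.TTheory GRing.Theory Num.Theory.

Local Open Scope ring_scope.
Local Open Scope complex_scope.

(* Rows and columns are numbered from 0 here, so the entry in (1-based)
   position (n, n+1) is at ordinals (n-1, n): its value sqrt n is the square
   root of the larger of the two ordinals. *)
Definition coupling_mx (R : realType) (M : nat) : 'M[R]_(M.+1) :=
  \matrix_(i, j)
    if (j == i.+1 :> nat)%N then Num.sqrt j%:R
    else if (i == j.+1 :> nat)%N then Num.sqrt i%:R
    else 0.

Definition wavenumber (R : realType) (D : R) : R := 2 * pi / D.

Definition filter_mx (R : realType) (M : nat) (h : 'I_M.+1 -> R) :
    'M[R]_(M.+1) :=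
  diag_mx (\row_i h i).

Definition mode_mx (R : realType) (M : nat) (D : R) (h : 'I_M.+1 -> R)
    (m : int) : 'M[R[i]]_(M.+1) :=
  - ('i%C * (m%:~R * wavenumber D)%:C)
      *: map_mx (real_complex R) (coupling_mx R M)
  + map_mx (real_complex R) (filter_mx h).

(* Main.v *)
(** Testing the eigenvector equation [v A_m = lambda v] against the conjugate of
    [v], the skew-Hermitian part [-i m k A] contributes nothing to the real part,
    so [Re lambda * sum_j |v_j|^2 = sum_j h_j |v_j|^2 <= h_M |v_M|^2].
    Moreover [v_M <> 0]: otherwise, since the superdiagonal of [A_m] does not
    vanish, the equation at columns M, M-1, ..., 1 successively forces
    [v_{M-1} = ... = v_0 = 0]. *)

Require Import Defs.
From HB Require Import structures.
From mathcomp Require Import all_boot all_order all_algebra.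
From mathcomp Require Import complex.
From mathcomp Require Import reals trigo.

Import Order.TTheory GRing.Theory Num.Theory.

Local Open Scope ring_scope.

(** Conjugating the double sum and exchanging its two indices gives [S^* = - S], so [S] is purely
    imaginary. *)
Lemma skew_hermitian_form_Re (C : numClosedFieldType) (n : nat)
    (B : 'M[C]_n) (v : 'rV[C]_n) :
  (forall i j, B j i = - (B i j)^*) ->
  'Re (\sum_j (v *m B) 0 j * (v 0 j)^*) = 0.
Proof.
move=> skewB; set S := \sum_j _.
suff SC : S^* = - S by rewrite ReE SC subrr mul0r.
have SE : S = \sum_j \sum_i v 0 i * B i j * (v 0 j)^*.
  by apply: eq_bigr => j _; rewrite mxE mulr_suml.
rewrite {1}SE rmorph_sum /= SE exchange_big /= -sumrN; apply: eq_bigr => j _.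
rewrite rmorph_sum /= -sumrN; apply: eq_bigr => i _.
by rewrite !rmorphM /= conjCK (skewB i j) mulrN mulNr opprK mulrC [_^* * _]mulrC mulrA.
Qed.

(** Multiply column [j] of the eigenvector equation by the conjugate of [v 0 j], sum over [j] and
    take real parts. Both weighted sums of squared moduli are real, so only the form in [B] drops
    out. *)
Lemma eigenvector_Re (C : numClosedFieldType) (n : nat) (B : 'M[C]_n)
    (d v : 'rV[C]_n) (lambda : C) :
  (forall i j, B j i = - (B i j)^*) -> (forall j, d 0 j \is Num.real) ->
  v *m (B + diag_mx d) = lambda *: v ->
  'Re lambda * \sum_j `|v 0 j| ^+ 2 = \sum_j d 0 j * `|v 0 j| ^+ 2.
Proof.
move=> skewB dR vE.
have sumR : \sum_j `|v 0 j| ^+ 2 \is Num.real.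
  by apply: rpred_sum => j _; rewrite realX ?normr_real.
have sumdR : \sum_j d 0 j * `|v 0 j| ^+ 2 \is Num.real.
  by apply: rpred_sum => j _; rewrite realM ?realX ?normr_real.
have formE : lambda * \sum_j `|v 0 j| ^+ 2 =
    \sum_j (v *m B) 0 j * (v 0 j)^* + \sum_j d 0 j * `|v 0 j| ^+ 2.
  rewrite mulr_sumr -big_split /=; apply: eq_bigr => j _.
  have /rowP/(_ j) := vE; rewrite mulmxDr mul_mx_diag !mxE => vEj.
  by rewrite normCK mulrA -vEj mulrDl [v 0 j * d 0 j]mulrC -mulrA.
have := congr1 (fun z => 'Re z) formE.
rewrite raddfD /= skew_hermitian_form_Re // add0r (Creal_ReP _ sumdR) => <-.
by rewrite ReMr.
Qed.

Lemma hessenberg_eigenvector_eq0 (F : fieldType) (M : nat) (B : 'M[F]_(M.+1))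
    (v : 'rV[F]_(M.+1)) (lambda : F) :
  (forall i j : 'I_M.+1, (i.+1 < j)%N -> B i j = 0) ->
  (forall i j : 'I_M.+1, j = i.+1 :> nat -> B i j != 0) ->
  v *m B = lambda *: v -> v 0 ord_max = 0 -> v = 0.
Proof.
move=> B0 Bneq0 vE vM; apply/rowP => i; rewrite mxE.
(* Strong induction on a bound [k] for the distance from [i] to the last index runs through the
   coordinates downwards. *)
have [k le_Mik] : exists k, (M <= i + k)%N by exists M; rewrite leq_addl.
elim/ltn_ind: k i le_Mik => k IHk i le_Mik.
have [i_ltM|i_geM] := ltnP i M; last first.
  by rewrite (_ : i = ord_max) //; apply/val_inj/anti_leq; rewrite -ltnS ltn_ord.
have k_gt0 : (0 < k)%N by case: k le_Mik {IHk} => //; rewrite addn0 leqNgt i_ltM.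
have v_gt0 (j : 'I_M.+1) : (i < j)%N -> v 0 j = 0.
  move=> ij; apply: (IHk k.-1); first by rewrite prednK.
  by rewrite (leq_trans le_Mik) // -[in leqLHS](prednK k_gt0) addnS -addSn leq_add2r.
pose j : 'I_M.+1 := Ordinal (i_ltM : (i.+1 < M.+1)%N).
(* Column [i + 1] reduces to [v 0 i * B i j = 0]: the terms [l < i] vanish through [B], the terms
   [l > i] through [v]. *)
have /rowP/(_ j) := vE; rewrite !mxE (v_gt0 j) // mulr0 (bigD1 i) //= big1 => [|l].
  by rewrite addr0 => /eqP; rewrite mulf_eq0 (negPf (Bneq0 i j _)) // orbF => /eqP.
rewrite -val_eqE neq_ltn => /orP[li|il]; first by rewrite B0 ?mulr0.
by rewrite v_gt0 ?mul0r.
Qed.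

Local Open Scope complex_scope.

Theorem theorem1 (R : realType) (M : nat) (D : R) (h : 'I_M.+1 -> R)
    (M_ge1 : (1 <= M)%N) (D_gt0 : 0 < D)
    (h_le0 : forall i : 'I_M.+1, h i <= 0)
    (h_first : h ord0 = 0) (h_last : h ord_max != 0)
    (m : int) (m_neq0 : m != 0) (lambda : R[i]) :
  eigenvalue (mode_mx D h m) lambda -> complex.Re lambda < 0.
Proof.
case/eigenvalueP => v vE v_neq0.
pose c : R := m%:~R * wavenumber D.
pose B := - ('i%C * c%:C) *: map_mx (real_complex R) (coupling_mx R M).
pose d : 'rV[R[i]]_M.+1 := \row_j (h j)%:C.
have c_neq0 : c != 0.
  by rewrite mulf_neq0 ?intr_eq0 // !mulf_neq0 ?invr_eq0 ?gt_eqF ?pi_gt0.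
have modeE : mode_mx D h m = B + diag_mx d.
  by rewrite /mode_mx /filter_mx map_diag_mx; congr (_ + diag_mx _); apply/rowP => j; rewrite !mxE.
have skewB i j : B j i = - Num.conj (B i j).
  have -> : B j i = - ('i%C * c%:C) * (coupling_mx R M i j)%:C.
    rewrite !mxE; congr (_ * _%:C).
    (* Transposing swaps the order of the two tests; this is harmless since they cannot both
       succeed. *)
    case: eqP => [ij|_]; case: eqP => [ji|_] //.
    by have := leqnn i; rewrite {1}ij ji ltnNge leqnSn.
  rewrite !mxE; set a := (X in X%:C); apply/eqP.
  by rewrite eq_complex /= !(mul0r, mulr0, mul1r, addr0, add0r, subr0, sub0r, oppr0, opprK) !eqxx.
have dR j : d 0 j \is Num.real by rewrite mxE complex_real.
have vM_neq0 : v 0 ord_max != 0.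
  apply: contraNneq v_neq0 => vM.
  apply/eqP.
  apply: (@hessenberg_eigenvector_eq0 _ _ (mode_mx D h m) _ lambda) => // i j ij.
    rewrite modeE !mxE.
    have i_ltj : (i < j)%N by rewrite ltnW.
    rewrite -val_eqE /= (gtn_eqF ij) (ltn_eqF i_ltj) (ltn_eqF (leqW i_ltj)).
    by rewrite mulr0 addr0.
  (* The superdiagonal entry is [-i c] times the square root of [i + 1], nonzero because [c] is. *)
  rewrite modeE !mxE -val_eqE /= ij eqxx (ltn_eqF (ltnSn i)) addr0 mulf_neq0 //; last first.
    by rewrite fmorph_eq0 sqrtr_eq0 -ltNge ltr0n.
  by rewrite oppr_eq0 mulf_neq0 // ?fmorph_eq0 // eq_complex /= oner_eq0 andbF.
have ReE := @eigenvector_Re _ _ B d v lambda skewB dR (etrans (congr1 (mulmx v) (esym modeE)) vE).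
have sum_gt0 : 0 < \sum_j `|v 0 j| ^+ 2.
  rewrite (bigD1 ord_max) //=; apply: ltr_pwDl; first by rewrite exprn_gt0 ?normr_gt0.
  by apply: sumr_ge0 => j _; rewrite exprn_ge0.
(* The comparison moves to the order of [R[i]], where the last term of the sum is strictly negative
   and the others are nonpositive. *)
rewrite -ltcR complexRe -(pmulr_llt0 _ sum_gt0) ReE (bigD1 ord_max) //=.
apply: ltr_nwDl.
  by rewrite nmulr_rlt0 ?exprn_gt0 ?normr_gt0 // mxE ltcR lt_neqAle h_last h_le0.
by apply: sumr_le0 => j _; rewrite mulr_le0_ge0 ?exprn_ge0 // mxE lecR.
Qed.
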